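(* Let $q$ be an indeterminate and let $m,n,r\geq 0$ and $k\ge 0$ be integers. Then $$S_q^{(r)}(m+n,k)=\sum_{i=0}^n \sum_{j=0}^m q^{i(j+r)}[j+r]_q^{\,n-i}\binom{n}{i} S_q^{(r)}(m,j)\,S_q(i,k-j)$$ and $$B_q^{(r)}(m+n)=\sum_{i=0}^n \sum_{j=0}^m q^{i(j+r)}[j+r]_q^{\,n-i}\binom{n}{i} S_q^{(r)}(m,j)\, B_q(i).$$
   Context: For an integer $a\ge1$, $a_q=[a]_q=1+q+\cdots+q^{a-1}$, and $0_q=0$. A partition of $[n]=\{1,\dots,n\}$ is a set of nonempty disjoint blocks with union $[n]$. For a partition $\pi=B_1/B_2/\cdots/B_k$ of a finite set of positive integers written with $\min B_1<\min B_2<\cdots<\min B_k$, let $w(\pi)=\sum_{i=1}^k (i-1)|B_i|$. Let $S_q(n,k)=\sum_{\pi}q^{w(\pi)}$, summed over all partitions $\pi$ of $[n]$ into $k$ blocks (so $S_q(0,0)=1$, and $S_q(n,k)=0$ if $k>n$ or $k<0$), and $B_q(n)=\sum_{k=0}^n S_q(n,k)$. For $r\ge0$, let $\mathcal{P}^{(r)}_{n,k}$ be the set of partitions of $[n+r]$ into $k+r$ blocks in which $1,2,\dots,r$ lie in distinct blocks, and define $S_q^{(r)}(n,k)=\sum_{\pi\in\mathcal{P}^{(r)}_{n,k}}q^{w(\pi)}$ and $B_q^{(r)}(n)=\sum_{k=0}^n S_q^{(r)}(n,k)$. *)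

(* Defs.v *)
From HB Require Import structures.
From mathcomp Require Import all_boot all_order all_algebra.

Set Implicit Arguments.
Unset Strict Implicit.
Unset Printing Implicit Defensive.

Import Order.TTheory GRing.Theory Num.Theory.

Local Open Scope ring_scope.

(* The indeterminate q is 'X : {poly int}.  The set [n] = {1, ..., n} is
   represented by 'I_n, the ordinal x standing for the integer x + 1. *)

Definition qint (a : nat) : {poly int} := \sum_(i < a) 'X^i.

(* The value n for B = set0 is junk: blocks are nonempty. *)
Definition block_min (n : nat) (B : {set 'I_n}) : nat :=
  \big[minn/n]_(x in B) (x : nat).

(* The list B_1, ..., B_k with min B_1 < ... < min B_k. *)
Definition standard_form (n : nat) (P : {set {set 'I_n}}) : seq {set 'I_n} :=
  sort (fun A B => block_min A <= block_min B)%N (enum P).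

(* The list is indexed from 0, so the factor i is the i - 1 of the usual
   1-based numbering of the blocks. *)
Definition weight (n : nat) (P : {set {set 'I_n}}) : nat :=
  (\sum_(i < size (standard_form P)) i * #|nth set0 (standard_form P) i|)%N.

(* The index k ranges over int so that S_q(n, k) = 0 for k < 0. *)
Definition Sq (n : nat) (k : int) : {poly int} :=
  \sum_(P : {set {set 'I_n}} | partition P [set: 'I_n] && (#|P|%:Z == k))
    'X^(weight P).

Definition Bq (n : nat) : {poly int} := \sum_(k < n.+1) Sq n k%:Z.

(* The integers 1, ..., r are the ordinals x < r. *)
Definition first_distinct (n r : nat) (P : {set {set 'I_n}}) : bool :=
  [forall x : 'I_n, forall y : 'I_n,
    [&& (x < r)%N, (y < r)%N & x != y] ==> (pblock P x != pblock P y)].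

Definition r_partitions (r n k : nat) : {set {set {set 'I_(n + r)}}} :=
  [set P | [&& partition P [set: 'I_(n + r)], #|P| == (k + r)%N
             & first_distinct r P]].

Definition Srq (r n k : nat) : {poly int} :=
  \sum_(P in r_partitions r n k) 'X^(weight P).

Definition Brq (r n : nat) : {poly int} := \sum_(k < n.+1) Srq r n k.

(* Main.v *)
Require Import Defs.
From HB Require Import structures.
From mathcomp Require Import all_boot all_order all_algebra.
From mathcomp Require Import ring.

Set Implicit Arguments.
Unset Strict Implicit.
Unset Printing Implicit Defensive.

Import Order.TTheory GRing.Theory Num.Theory.

Local Open Scope ring_scope.

(** The largest element of a partition of [N+1] into K blocks is either a
    singleton, which is then the last block and contributes q^(K-1), or is
    inserted into one of the K blocks of a partition of [N], and the position
    of that block contributes a factor 1 + q + ... + q^(K-1).  This gives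
      S^(r)(n+1,k) = q^(k+r-1) S^(r)(n,k-1) + [k+r] S^(r)(n,k).
    Splitting [k+r] = [j+r] + q^(j+r) [k-j] and using Pascal's rule, the
    right-hand side of the convolution formula satisfies, for each j, the same
    recurrence in n; the formula for B^(r) follows by summing over k. *)

(** * Minima of blocks, and partitions of the full set *)

Lemma leq_block_min (n v : nat) (B : {set 'I_n}) :
  reflect ((v <= n)%N /\ forall x, x \in B -> (v <= x)%N) (v <= block_min B)%N.
Proof.
exact: (@bigmin_geP _ nat _ n v (mem B) (fun x => x : nat)).
Qed.

Lemma block_min_leq (n : nat) (B : {set 'I_n}) : (block_min B <= n)%N.
Proof. by have /leq_block_min[] := leqnn (block_min B). Qed.

Lemma block_min_le (n : nat) (B : {set 'I_n}) (x : 'I_n) :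
  x \in B -> (block_min B <= x)%N.
Proof. by have /leq_block_min[_] := leqnn (block_min B); apply. Qed.

Lemma block_min_in (n : nat) (B : {set 'I_n}) :
  B != set0 -> exists2 x, x \in B & block_min B = x.
Proof.
case/set0Pn=> x0 x0B.
case: (arg_minnP (fun x : 'I_n => x : nat) x0B) => x xB xmin.
exists x => //; apply/eqP; rewrite eqn_leq block_min_le //=.
by apply/leq_block_min; split=> //; exact: ltnW.
Qed.

Lemma block_min_set0 (n : nat) : block_min (set0 : {set 'I_n}) = n.
Proof.
apply/eqP; rewrite eqn_leq block_min_leq; apply/leq_block_min; split=> // x.
by rewrite inE.
Qed.

Lemma partition_setTP (T : finType) (P : {set {set T}}) :
  reflect [/\ set0 \notin P, forall x, exists2 B, B \in P & x \in B
            & forall A B x, A \in P -> B \in P -> x \in A -> x \in B -> A = B]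
          (partition P [set: T]).
Proof.
apply: (iffP and3P) => [[/eqP cP /trivIsetP tP P0]|[P0 cP tP]]; split=> //.
- by move=> x; apply/bigcupP; rewrite -/(cover P) cP.
- move=> A B x AP BP xA xB; apply/eqP/negPn/negP=> /(tP _ _ AP BP).
  by move/disjoint_setI0/setP/(_ x); rewrite !inE xA xB.
- by apply/eqP/setP=> x; rewrite inE; apply/bigcupP; exact: cP.
- apply/trivIsetP=> A B AP BP; apply: contraR => /pred0Pn[x /andP[xA xB]].
  by apply/eqP; exact: (tP _ _ x).
Qed.

(** A nonempty block contains its minimum, so two blocks with equal minima share an element and
    coincide. *)
Lemma block_min_inj (n : nat) (P : {set {set 'I_n}}) :
  partition P [set: 'I_n] -> {in P &, injective (@block_min n)}.
Proof.
case/partition_setTP=> P0 _ tP A B AP BP.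
have nz C : C \in P -> C != set0 by apply: contraTneq => ->.
have [x xA ->] := block_min_in (nz _ AP).
have [y yB ->] := block_min_in (nz _ BP).
by move=> /val_inj xy; apply: (tP _ _ x) => //; rewrite xy.
Qed.

(** * The weight without sorting: positions of blocks as counts of smaller minima *)

Definition nb_below (n : nat) (P : {set {set 'I_n}}) (v : nat) : nat :=
  (\sum_(C in P) (block_min C < v))%N.

(** The minima are strictly increasing along the standard form, because distinct blocks have
    distinct minima; hence exactly i of them lie below the one at index i. *)
Lemma nb_below_nth (n : nat) (P : {set {set 'I_n}}) (i : nat) :
  partition P [set: 'I_n] -> (i < size (standard_form P))%N ->
  nb_below P (block_min (nth set0 (standard_form P) i)) = i.
Proof.
move=> /block_min_inj inj ilt; set s := standard_form P in ilt *.
have sP : perm_eq s (enum P) by rewrite /s /standard_form perm_sort.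
have srt : sorted ltn [seq block_min C | C <- s].
  rewrite ltn_sorted_uniq_leq map_inj_in_uniq; last first.
    by move=> A B; rewrite !(perm_mem sP) !mem_enum; exact: inj.
  rewrite (perm_uniq sP) enum_uniq sorted_map /=.
  by apply: sort_sorted => A B; exact: leq_total.
rewrite -(nth_map set0 0%N)//; set v := nth _ _ _.
transitivity (count (fun u => u < v)%N [seq block_min C | C <- s]).
  rewrite /nb_below -big_enum -(perm_big _ sP) -sum1_count [RHS]big_mkcond.
  by rewrite big_map; apply: eq_bigr => C _; case: ltnP.
by apply: (@Order.PreorderTheory.count_lt_nth _ nat); rewrite ?size_map.
Qed.

(** Replaces the sorted list by an unordered sum, which is easier to follow under insertion. [V] is
    general so as to serve both the weight, in [nat], and the sum of powers of q, in
    [{poly int}]. *)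
Lemma sum_standard_form (V : nmodType) (n : nat) (P : {set {set 'I_n}})
    (F : nat -> {set 'I_n} -> V) :
  partition P [set: 'I_n] ->
  \sum_(i < size (standard_form P)) F i (nth set0 (standard_form P) i) =
  \sum_(B in P) F (nb_below P (block_min B)) B.
Proof.
move=> partP; rewrite -[RHS]big_enum.
have sP : perm_eq (standard_form P) (enum P) by rewrite perm_sort.
rewrite -[RHS](perm_big _ sP) (big_nth set0) big_mkord.
by apply: eq_bigr => i _; rewrite nb_below_nth.
Qed.

Lemma size_standard_form (n : nat) (P : {set {set 'I_n}}) :
  size (standard_form P) = #|P|.
Proof. by rewrite size_sort -cardE. Qed.

Lemma weightE (n : nat) (P : {set {set 'I_n}}) : partition P [set: 'I_n] ->
  weight P = (\sum_(B in P) nb_below P (block_min B) * #|B|)%N.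
Proof. exact: (sum_standard_form (fun i B => i * #|B|)%N). Qed.

(** Each position 0, ..., #|P| - 1 is taken once. This is the source of the q-integer in the
    recurrence. *)
Lemma sum_nb_below (n : nat) (P : {set {set 'I_n}}) : partition P [set: 'I_n] ->
  \sum_(B in P) 'X^(nb_below P (block_min B)) = qint #|P|.
Proof.
move=> partP; rewrite -(sum_standard_form (fun i _ => 'X^i)) //.
by rewrite size_standard_form.
Qed.

(** * Inserting and removing the largest element *)

Section Insertion.

Variable n : nat.

Implicit Types (B C : {set 'I_n}) (P : {set {set 'I_n}}).
Implicit Types (X : {set 'I_n.+1}) (Q : {set {set 'I_n.+1}}).

Let emb : 'I_n -> 'I_n.+1 := lift ord_max.

Let emb_val x : emb x = x :> nat.
Proof. by rewrite /= /bump leqNgt ltn_ord. Qed.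

Let emb_inj : injective emb. Proof. exact: lift_inj. Qed.

Let embN x : (emb x == ord_max) = false.
Proof. by apply/negbTE; rewrite eq_sym neq_lift. Qed.

Definition lift_block B : {set 'I_n.+1} := emb @: B.

Definition lower_block X : {set 'I_n} := emb @^-1: X.

(* Both kinds of insertion at once: for B in P the new element joins B, for
   B = set0 it forms a block of its own.  The junk value block_min set0 = n
   is then the correct minimum of the new block. *)
Definition insert_max P B : {set {set 'I_n.+1}} :=
  (ord_max |: lift_block B) |: (lift_block @: (P :\ B)).

(** If the maximum is alone in its block, lowering makes that block empty, and it has to be
    dropped. *)
Definition remove_max Q : {set {set 'I_n}} := (lower_block @: Q) :\ set0.

Lemma mem_lift_block B x : (emb x \in lift_block B) = (x \in B).
Proof. by rewrite mem_imset. Qed.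

Lemma max_notin_lift_block B : ord_max \notin lift_block B.
Proof. by apply/imsetP=> -[x _ /eqP]; rewrite eq_sym embN. Qed.

Lemma lift_block_inj : injective lift_block.
Proof. exact: imset_inj. Qed.

Lemma lift_blockK : cancel lift_block lower_block.
Proof. by move=> B; apply/setP=> x; rewrite inE mem_lift_block. Qed.

Lemma lower_blockU1 B : lower_block (ord_max |: lift_block B) = B.
Proof. by apply/setP=> x; rewrite !inE embN mem_lift_block. Qed.

Lemma lower_blockK X : lift_block (lower_block X) = X :\ ord_max.
Proof.
apply/setP=> x; rewrite !inE; have [y|->] := unliftP ord_max x.
  by move=> ->; rewrite mem_lift_block inE embN.
by rewrite eqxx (negbTE (max_notin_lift_block _)).
Qed.

Lemma lift_block_eq0 B : (lift_block B == set0) = (B == set0).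
Proof. exact: imset_eq0. Qed.

Lemma insert_maxP P B X :
  reflect (X = ord_max |: lift_block B \/
           exists2 C, C \in P & C != B /\ X = lift_block C)
          (X \in insert_max P B).
Proof.
rewrite in_setU1; apply: (iffP orP) => [[/eqP->|/imsetP[C]]|[->|[C CP [CB ->]]]].
- by left.
- by rewrite !inE => /andP[CB CP] ->; right; exists C.
- by left.
- by right; apply/imsetP; exists C; rewrite // !inE CB.
Qed.

Lemma insert_max_fresh P B :
  ord_max |: lift_block B \notin lift_block @: (P :\ B).
Proof.
apply/negP=> /imsetP[C _ /setP/(_ ord_max)].
by rewrite setU11 (negbTE (max_notin_lift_block _)).
Qed.

Lemma insert_max_partition P B : partition P [set: 'I_n] -> B \in set0 |: P ->
  partition (insert_max P B) [set: 'I_n.+1].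
Proof.
move=> /partition_setTP[P0 cP tP] BP; apply/partition_setTP; split.
- apply/negP=> /insert_maxP[/setP/(_ ord_max)|[C CP [_ /esym/eqP]]].
    by rewrite !inE eqxx.
  by rewrite lift_block_eq0 => /eqP C0; rewrite -C0 CP in P0.
- move=> x; have [y|] := unliftP ord_max x => ->; last first.
    exists (ord_max |: lift_block B); last by rewrite setU11.
    by apply/insert_maxP; left.
  have [C CP yC] := cP y; have [CB|CB] := eqVneq C B.
    exists (ord_max |: lift_block B); first by apply/insert_maxP; left.
    by rewrite in_setU1 mem_lift_block -CB yC orbT.
  exists (lift_block C); last by rewrite mem_lift_block.
  by apply/insert_maxP; right; exists C.
(* [B] is a block or empty, so a block meeting [B] is [B] itself. *)
- have tB C x : C \in P -> x \in C -> x \in B -> C = B.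
    move=> CP xC xB; apply: (tP _ _ x) => //; move: BP; rewrite in_setU1.
    by case/predU1P=> // B0; rewrite B0 inE in xB.
  move=> X Y x /insert_maxP[->|[C CP [CB ->]]] /insert_maxP[->|[D DP [DB ->]]] //;
    have [y|] := unliftP ord_max x => ->;
    rewrite ?in_setU1 ?embN ?mem_lift_block ?(negbTE (max_notin_lift_block _)) //=.
  + by move=> yB yD; case/eqP: DB; exact: tB yB.
  + by move=> yC yB; case/eqP: CB; exact: tB yB.
  + by move=> yC yD; rewrite (tP _ _ _ CP DP yC yD).
Qed.

Lemma remove_maxP Q B :
  reflect (B != set0 /\ exists2 X, X \in Q & B = lower_block X)
          (B \in remove_max Q).
Proof.
by rewrite 2!inE; apply: (iffP andP) => -[B0 /imsetP].
Qed.

Lemma remove_max_partition Q : partition Q [set: 'I_n.+1] ->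
  partition (remove_max Q) [set: 'I_n].
Proof.
move=> /partition_setTP[Q0 cQ tQ]; apply/partition_setTP; split.
- by rewrite !inE eqxx.
- move=> x; have [X XQ xX] := cQ (emb x); exists (lower_block X).
    apply/remove_maxP; split; last by exists X.
    by apply/set0Pn; exists x; rewrite inE.
  by rewrite inE.
- move=> A B x /remove_maxP[_ [X XQ ->]] /remove_maxP[_ [Y YQ ->]].
  by rewrite !inE => xX xY; rewrite (tQ _ _ _ XQ YQ xX xY).
Qed.

Lemma lower_pblock_max Q : partition Q [set: 'I_n.+1] ->
  lower_block (pblock Q ord_max) \in set0 |: remove_max Q.
Proof.
move=> partQ; rewrite in_setU1; case: eqVneq => //= A0; apply/remove_maxP.
split=> //; exists (pblock Q ord_max) => //.
by rewrite pblock_mem // (cover_partition partQ).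
Qed.

(** Together with [insert_maxK], this makes insertion a bijection from the pairs of a partition P of
    [n] and a choice B in [set0 |: P] onto the partitions of [n+1]. *)
Lemma remove_maxK Q : partition Q [set: 'I_n.+1] ->
  insert_max (remove_max Q) (lower_block (pblock Q ord_max)) = Q.
Proof.
move=> partQ; set A := pblock Q ord_max.
have AQ : A \in Q by rewrite pblock_mem // (cover_partition partQ).
have maxA : ord_max \in A by rewrite mem_pblock (cover_partition partQ).
have A'K : ord_max |: lift_block (lower_block A) = A.
  by rewrite lower_blockK setD1K.
case/partition_setTP: partQ => Q0 cQ tQ.
(* Blocks other than [A] do not contain the maximum, so lowering loses nothing. *)
have CK X : X \in Q -> X != A -> lift_block (lower_block X) = X.
  move=> XQ XA; rewrite lower_blockK; apply/setDidPl; rewrite disjoint_sym disjoints1.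
  by apply: contraNN XA => maxX; rewrite (tQ _ _ _ XQ AQ maxX maxA).
apply/setP=> X; apply/insert_maxP/idP; rewrite A'K.
  case=> [->//|[C /remove_maxP[C0 [Y YQ CY]] [CA ->]]].
  by rewrite CY CK //; apply: contraNneq CA => <-; rewrite CY.
move=> XQ; have [|XA] := eqVneq X A; [by left|right].
have X0 : lower_block X != set0.
  rewrite -lift_block_eq0 CK //; by apply: contraNneq Q0 => <-.
exists (lower_block X); first by apply/remove_maxP; split=> //; exists X.
split; last by rewrite CK.
case/set0Pn: X0 => x xX; apply: contraNneq XA => XA; move: (xX).
rewrite XA; rewrite inE in xX; rewrite inE => xA.
by rewrite (tQ _ _ _ XQ AQ xX xA).
Qed.

Lemma insert_maxK P B : partition P [set: 'I_n] -> B \in set0 |: P ->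
  remove_max (insert_max P B) = P /\
  lower_block (pblock (insert_max P B) ord_max) = B.
Proof.
move=> partP BP; have partQ := insert_max_partition partP BP; split; last first.
  rewrite (@def_pblock _ _ (ord_max |: lift_block B)) ?setU11 //.
    exact: lower_blockU1.
  exact: partition_trivIset partQ.
have P0 := partition0 partP.
rewrite /remove_max imsetU1 lower_blockU1 -imset_comp.
rewrite (eq_imset _ lift_blockK) imset_id.
move: BP; rewrite in_setU1 => /predU1P[->|BP].
  rewrite setU1K ?setD11 //; apply/setDidPl.
  by rewrite disjoint_sym disjoints1 P0.
rewrite setD1K //; apply/setDidPl.
by rewrite disjoint_sym disjoints1 P0.
Qed.

Lemma card_insert_max P B : partition P [set: 'I_n] -> B \in set0 |: P ->
  #|insert_max P B| = (#|P| + (B == set0))%N.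
Proof.
move=> partP; rewrite cardsU1 insert_max_fresh card_imset; last exact: lift_block_inj.
have P0 := partition0 partP.
rewrite in_setU1 => /predU1P[->|BP].
  by rewrite eqxx [#|P|](cardsD1 set0) P0 addnC.
have -> : (B == set0) = false by apply: contraTF BP => /eqP ->; rewrite P0.
by rewrite addn0 (cardsD1 B P) BP.
Qed.

Lemma block_min_lift B : B != set0 -> block_min (lift_block B) = block_min B.
Proof.
move=> B0; have [x xB bx] := block_min_in B0.
have B'0 : lift_block B != set0 by rewrite lift_block_eq0.
have [_ /imsetP[y yB ->] by_] := block_min_in B'0.
apply/eqP; rewrite eqn_leq {2}by_ emb_val block_min_le // bx -(emb_val x).
by rewrite block_min_le // mem_lift_block.
Qed.

(** The new element, of value n, exceeds all members of [B]; for empty [B] both sides are n. *)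
Lemma block_min_insert B : block_min (ord_max |: lift_block B) = block_min B.
Proof.
apply/eqP; rewrite eqn_leq; apply/andP; split; apply/leq_block_min; split.
- exact: (block_min_le (setU11 ord_max _)).
- move=> x xB; rewrite -(emb_val x) block_min_le //.
  by rewrite in_setU1 mem_lift_block xB orbT.
- exact: leq_trans (block_min_leq B) (leqnSn n).
- move=> x /setU1P[->|/imsetP[y yB ->]]; first exact: block_min_leq.
  by rewrite emb_val block_min_le.
Qed.

Lemma sum_insert_max (F : {set 'I_n.+1} -> nat) P B :
  (\sum_(X in insert_max P B) F X =
   F (ord_max |: lift_block B) + \sum_(C in P :\ B) F (lift_block C))%N.
Proof.
rewrite big_setU1 ?insert_max_fresh //= big_imset // => ? ? _ _.
exact: lift_block_inj.
Qed.

(** Lifting or enlarging a block keeps its minimum, and a new singleton has minimum n, which no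
    threshold v <= n counts. *)
Lemma nb_below_insert_max P B (v : nat) :
  partition P [set: 'I_n] -> B \in set0 |: P -> (v <= n)%N ->
  nb_below (insert_max P B) v = nb_below P v.
Proof.
move=> partP; have P0 := partition0 partP.
rewrite /nb_below sum_insert_max block_min_insert in_setU1 => + vn.
rewrite [in LHS](eq_bigr (fun C => (block_min C < v)%N : nat)); last first.
  move=> C /setD1P[_ CP]; rewrite block_min_lift //.
  by apply: contraTneq CP => ->; rewrite P0.
case/predU1P=> [->|BP]; last by rewrite [RHS](big_setD1 B).
rewrite block_min_set0 ltnNge vn add0n.
by apply: eq_bigl => C; rewrite !inE; case: eqVneq => // ->; rewrite P0.
Qed.

(** Old blocks keep their positions, so the weight grows by the position of the block that receives
    the new element; a new singleton comes last. *)
Lemma weight_insert_max P B : partition P [set: 'I_n] -> B \in set0 |: P ->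
  weight (insert_max P B) = (weight P + nb_below P (block_min B))%N.
Proof.
move=> partP BP; have P0 := partition0 partP.
rewrite !weightE ?insert_max_partition // sum_insert_max.
rewrite block_min_insert nb_below_insert_max ?block_min_leq //.
rewrite [in LHS](eq_bigr (fun C => nb_below P (block_min C) * #|C|)%N); last first.
  move=> C /setD1P[_ CP]; rewrite block_min_lift; last first.
    by apply: contraTneq CP => ->; rewrite P0.
  rewrite nb_below_insert_max ?block_min_leq // card_imset //.
(* The receiving block has size #|B| + 1, and the extra 1 yields the increment. *)
rewrite cardsU1 max_notin_lift_block card_imset // mulnDr muln1 -addnA addnC.
congr addn; move: BP; rewrite in_setU1 => /predU1P[->|BP].
  rewrite cards0 muln0 add0n.
  by apply: eq_bigl => C; rewrite !inE; case: eqVneq => // ->; rewrite P0.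
by rewrite [RHS](big_setD1 B).
Qed.

End Insertion.

(** * The recurrence for partitions separating the first r elements *)

Lemma first_distinctP (n r : nat) (P : {set {set 'I_n}}) :
  partition P [set: 'I_n] ->
  reflect (forall B x y, B \in P -> x \in B -> y \in B ->
             (x < r)%N -> (y < r)%N -> x = y)
          (first_distinct r P).
Proof.
move=> partP; have trivP := partition_trivIset partP.
have coverP x : x \in cover P by rewrite (cover_partition partP).
apply: (iffP forallP) => [fdP B x y BP xB yB xr yr|fdP x].
  move/forallP/(_ y): (fdP x); rewrite xr yr (def_pblock trivP BP xB).
  by rewrite (def_pblock trivP BP yB) eqxx /=; case: eqVneq.
apply/forallP=> y; apply/implyP=> /and3P[xr yr]; apply: contraNneq => xy.
by rewrite (fdP (pblock P x) x y) ?pblock_mem ?mem_pblock // xy mem_pblock.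
Qed.

(** Since r <= n, the inserted element is not among the first r. *)
Lemma first_distinct_insert_max (n r : nat) (P : {set {set 'I_n}}) B :
  (r <= n)%N -> partition P [set: 'I_n] -> B \in set0 |: P ->
  first_distinct r (insert_max P B) = first_distinct r P.
Proof.
move=> rn partP BP; have partQ := insert_max_partition partP BP.
have emb_val (x : 'I_n) : lift ord_max x = x :> nat.
  by rewrite /= /bump leqNgt ltn_ord.
apply/(first_distinctP _ partQ)/(first_distinctP _ partP) => fd.
  move=> C x y CP xC yC xr yr; apply: (@lift_inj _ ord_max).
  have [CB|CB] := eqVneq C B.
    apply: (fd (ord_max |: lift_block B)); rewrite ?emb_val //.
    - by apply/insert_maxP; left.
    - by rewrite in_setU1 mem_lift_block -CB xC orbT.
    - by rewrite in_setU1 mem_lift_block -CB yC orbT.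
  apply: (fd (lift_block C)); rewrite ?emb_val ?mem_lift_block //.
  by apply/insert_maxP; right; exists C.
have fdl C x y : C \in P -> x \in lift_block C -> y \in lift_block C ->
    (x < r)%N -> (y < r)%N -> x = y.
  move=> CP /imsetP[x' x'C ->] /imsetP[y' y'C ->]; rewrite !emb_val => xr yr.
  by rewrite (fd _ _ _ CP x'C y'C).
move=> X x y /insert_maxP[->|[C CP [_ ->]]]; last exact: fdl.
move=> /setU1P[->|xB] /setU1P[->|yB] //=; rewrite ?[(n < r)%N]ltnNge ?rn //.
move: BP; rewrite in_setU1 => /predU1P[B0|BP]; last exact: fdl xB yB.
by move: xB; rewrite B0 /lift_block imset0 inE.
Qed.

(** Here n and k count all elements and all blocks, without the shift by r, so that one recurrence
    covers S_q^(r) and, with r = 0, S_q. *)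
Definition Sdist (r n k : nat) : {poly int} :=
  \sum_(P : {set {set 'I_n}} | [&& partition P [set: 'I_n], #|P| == k
                                 & first_distinct r P]) 'X^(weight P).

Lemma nb_below_size (n : nat) (P : {set {set 'I_n}}) :
  partition P [set: 'I_n] -> nb_below P n = #|P|.
Proof.
move=> partP; rewrite /nb_below -sum1_card; apply: eq_bigr => C CP.
have [x _ ->] := block_min_in (partition_neq0 partP CP).
by rewrite ltn_ord.
Qed.

Lemma Sdist_rec (r n k : nat) : (r <= n)%N ->
  Sdist r n.+1 k =
    (if k is k'.+1 then 'X^k' * Sdist r n k' else 0) + qint k * Sdist r n k.
Proof.
move=> rn; rewrite /Sdist.
pose h (p : {set {set 'I_n}} * {set 'I_n}) := insert_max p.1 p.2.
pose h' (Q : {set {set 'I_n.+1}}) :=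
  (remove_max Q, lower_block (pblock Q ord_max)).
rewrite (reindex_onto h h') => [|Q /andP[partQ _]]; last exact: remove_maxK.
pose V (P : {set {set 'I_n}}) := partition P [set: 'I_n] && first_distinct r P.
transitivity (\sum_(p | V p.1 &&
    ((p.2 \in set0 |: p.1) && (#|p.1| + (p.2 == set0) == k)%N))
    ('X^(weight p.1 + nb_below p.1 (block_min p.2)) : {poly int})).
  (* Being recovered from its insertion forces [p.2] to be empty or a block of [p.1], so the
     reindexed sum runs over the admissible choices only. *)
  have hV p : partition (h p) [set: 'I_n.+1] && (h' (h p) == p)
      = partition p.1 [set: 'I_n] && (p.2 \in set0 |: p.1).
    case: p => P B; apply/andP/andP => /= [[partQ /eqP[eP eB]]|[partP BP]].
      have := lower_pblock_max partQ; have := remove_max_partition partQ.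
      by rewrite eP eB.
    rewrite /h insert_max_partition //; split=> //.
    by rewrite /h' /h /=; have [-> ->] := insert_maxK partP BP.
  apply: eq_big => [p|p].
    rewrite andbAC hV /V; case: (boolP (partition p.1 [set: 'I_n])) => //= partP.
    case: (boolP (p.2 \in _)) => BP /=; last by rewrite !andbF.
    by rewrite card_insert_max // first_distinct_insert_max // andbC.
  rewrite andbAC => /andP[]; rewrite hV => /andP[partP BP] _.
  by rewrite weight_insert_max.
rewrite -(pair_big_dep V (fun P B => (B \in set0 |: P) &&
  (#|P| + (B == set0) == k)%N)
  (fun P B => ('X^(weight P + nb_below P (block_min B)) : {poly int}))) /=.
transitivity (\sum_(P | V P)
    ((if #|P|.+1 == k then 'X^(weight P + #|P|) else 0) +
     (if #|P| == k then qint k * 'X^(weight P) else 0))).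
  apply: eq_bigr => P /andP[partP _].
  have P0 := partition0 partP.
  (* The choice B = [set0] adds a block and, as its minimum is n, raises the exponent by #|P|. The
     blocks of P keep the count, and their positions sum to the q-integer. *)
  rewrite big_mkcondr big_setU1 ?P0 //= eqxx addn1 block_min_set0 nb_below_size //.
  congr (_ + _); case: (eqVneq #|P| k) => [<-|Pk]; last first.
    apply: big1 => B BP; rewrite (negbTE (partition_neq0 partP BP)) addn0.
    by rewrite (negbTE Pk).
  rewrite -sum_nb_below // mulr_suml; apply: eq_bigr => B BP.
  by rewrite (negbTE (partition_neq0 partP BP)) addn0 eqxx addnC exprD.
rewrite big_split -!big_mkcondr mulr_sumr; congr (_ + _); last first.
  by apply: eq_bigl => P; rewrite /V; case: (partition P _); rewrite //= andbC.
case: k => [|k]; first by apply: big1 => P; rewrite andbF.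
rewrite mulr_sumr; apply: eq_big => P.
  by rewrite /V eqSS; case: (partition P _); rewrite //= andbC.
by move=> /andP[_ /eqP[->]]; rewrite addnC exprD.
Qed.

Lemma card_partition_leq (T : finType) (P : {set {set T}}) (D : {set T}) :
  partition P D -> (#|P| <= #|D|)%N.
Proof.
move=> partP; rewrite (card_partition partP) -sum1_card; apply: leq_sum => B BP.
by rewrite card_gt0 (partition_neq0 partP BP).
Qed.

(** Sending each of the first r elements to its block is injective. *)
Lemma first_distinct_leq (n r : nat) (P : {set {set 'I_n}}) :
  (r <= n)%N -> partition P [set: 'I_n] -> first_distinct r P -> (r <= #|P|)%N.
Proof.
move=> rn partP /forallP fdP.
pose f (x : 'I_r) := pblock P (widen_ord rn x).
have f_inj : injective f.
  move=> x y fxy; apply/val_inj/eqP; rewrite -[_ == _]/(widen_ord rn x == widen_ord rn y).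
  move/forallP/(_ (widen_ord rn y)): (fdP (widen_ord rn x)).
  by rewrite /= !ltn_ord /= -/(f x) -/(f y) fxy eqxx; case: (_ == _).
rewrite -[leqLHS]card_ord -(card_imset _ f_inj) subset_leq_card //.
apply/subsetP=> _ /imsetP[x _ ->].
by rewrite pblock_mem // (cover_partition partP).
Qed.

Lemma Sdist_small (r n k : nat) : (k < r <= n)%N -> Sdist r n k = 0.
Proof.
case/andP=> kr rn; apply: big_pred0 => P; apply/negP=> /and3P[partP /eqP Pk fdP].
by move: (first_distinct_leq rn partP fdP); rewrite Pk leqNgt kr.
Qed.

Lemma Sdist_large (r n k : nat) : (n < k)%N -> Sdist r n k = 0.
Proof.
move=> nk; apply: big_pred0 => P; apply/negP=> /and3P[partP /eqP Pk _].
by move: (card_partition_leq partP); rewrite Pk cardsT card_ord leqNgt nk.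
Qed.

(** * Boundary values and recurrences of S_q and S_q^(r) *)

Lemma SrqE (r n k : nat) : Srq r n k = Sdist r (n + r) (k + r).
Proof. by apply: eq_bigl => P; rewrite inE. Qed.

Lemma SqE (n k : nat) : Sq n k = Sdist 0 n k.
Proof.
apply: eq_bigl => P; rewrite eqz_nat; case: (partition P _) => //=.
rewrite [first_distinct _ _](_ : _ = true) ?andbT //.
by apply/forallP=> x; apply/forallP.
Qed.

Lemma Sq_lt0 (n : nat) (l : int) : l < 0 -> Sq n l = 0.
Proof.
by move=> l0; apply: big_pred0 => P; case: l l0 => // l _; rewrite andbF.
Qed.

Lemma Sq_large (n k : nat) : (n < k)%N -> Sq n k = 0.
Proof. by rewrite SqE; exact: Sdist_large. Qed.

Lemma Sq00 : Sq 0 0%N = 1.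
Proof.
have w0 : weight (set0 : {set {set 'I_0}}) = 0%N.
  by rewrite /weight size_standard_form cards0 big_ord0.
rewrite /Sq (bigD1 set0) /=; last first.
  rewrite cards0 eqxx andbT (_ : [set: 'I_0] = set0) ?partition_set0 //.
  by apply/setP=> -[].
rewrite w0 big1 ?addr0 // => P /andP[/andP[_]].
by rewrite eqz_nat cards_eq0 => ->.
Qed.

Lemma SqS0 (n : nat) : Sq n.+1 0%N = 0.
Proof. by rewrite SqE Sdist_rec // add0r /qint big_ord0 mul0r. Qed.

Lemma SqSS (n k : nat) :
  Sq n.+1 k.+1 = 'X^k * Sq n k + qint k.+1 * Sq n k.+1.
Proof. by rewrite !SqE Sdist_rec. Qed.

Lemma Srq_large (r n k : nat) : (n < k)%N -> Srq r n k = 0.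
Proof. by move=> nk; rewrite SrqE Sdist_large // ltn_add2r. Qed.

Lemma Srq_rec (r n k : nat) :
  Srq r n.+1 k = (if k is k'.+1 then 'X^(k' + r) * Srq r n k' else 0) +
                 qint (k + r) * Srq r n k.
Proof.
rewrite !SrqE addSn Sdist_rec ?leq_addl //; congr (_ + _).
case: k => [|k]; last by rewrite SrqE.
(* For k = 0 and r > 0 the general recurrence leaves a term with r - 1 blocks, too few to separate r
   elements. *)
rewrite add0n; case: r => // r; rewrite Sdist_small ?mulr0 //.
by rewrite ltnSn leq_addl.
Qed.

(** * The convolution formula for S_q^(r) *)

Lemma qintD (a b : nat) : qint (a + b) = qint a + 'X^a * qint b.
Proof.
rewrite /qint big_split_ord /= mulr_sumr; congr (_ + _).
by apply: eq_bigr => i _; rewrite exprD.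
Qed.

(** For k > j, expand S_q(i+1, k-j) by its recurrence and use [k+r] = [j+r] + q^(j+r) [k-j]. The
    other cases rest on the vanishing of S_q at negative indices. *)
Lemma Sq_shift_rec (r i j k : nat) :
  qint (j + r) * Sq i (k%:Z - j%:Z) + 'X^(j + r) * Sq i.+1 (k%:Z - j%:Z) =
  (if k is k'.+1 then 'X^(k' + r) * Sq i (k'%:Z - j%:Z) else 0) +
  qint (k + r) * Sq i (k%:Z - j%:Z).
Proof.
have [kj|jk] := ltnP k j.
  rewrite !(@Sq_lt0 _ (k%:Z - j%:Z)) ?subr_lt0 ?ltz_nat // !mulr0 !addr0.
  by case: k kj => // k kj; rewrite Sq_lt0 ?mulr0 // subr_lt0 ltz_nat ltnW.
rewrite subzn //; case: (posnP (k - j)) => [kj0|kj_gt0].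
  (* For k = j, S_q(i+1, 0) = 0 on the left, and any predecessor term on the right has index -1. *)
  have -> : k = j by apply/eqP; rewrite eqn_leq jk -subn_eq0 kj0.
  rewrite subnn SqS0 mulr0 addr0.
  case: j {jk kj0} => [|j]; first by rewrite add0r.
  by rewrite (@Sq_lt0 _ (j%:Z - j.+1%:Z)) ?mulr0 ?add0r // subr_lt0 ltz_nat.
have [l kE] : exists l, k = (j + l).+1.
  by exists (k - j).-1; rewrite -addnS prednK // subnKC.
rewrite kE -addnS addKn addnS subzn ?leq_addr // addKn SqSS -addnS.
by rewrite (addnAC j l.+1 r) (addnAC j l r) (qintD (j + r)) (exprD _ (j + r)); ring.
Qed.

(** By Pascal's rule: the part with C(n, i) keeps s i and gains a factor b, while the part with C(n,
    i-1), reindexed, gains a factor a and shifts s. *)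
Lemma sum_binS (R : comNzRingType) (a b : R) (s : nat -> R) (n : nat) :
  \sum_(i < n.+2) a ^+ i * b ^+ (n.+1 - i) * ('C(n.+1, i))%:R * s i =
  \sum_(i < n.+1) a ^+ i * b ^+ (n - i) * ('C(n, i))%:R * (b * s i + a * s i.+1).
Proof.
under [RHS]eq_bigr do rewrite mulrDr; rewrite big_split /=.
rewrite [LHS]big_ord_recl; under [X in _ + X = _]eq_bigr do
  rewrite lift0 binS natrD mulrDr mulrDl; rewrite big_split /= addrA.
congr (_ + _); last first.
  by apply: eq_bigr => i _; rewrite subSS exprS; ring.
rewrite [X in _ + X = _]big_ord_recr /= (@bin_small n n.+1) // mulr0 mul0r addr0.
rewrite [RHS]big_ord_recl /= !bin0 !subn0; congr (_ + _).
  by rewrite exprS; ring.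
apply: eq_bigr => i _; rewrite /bump /= add1n subSS -subnSK //.
by rewrite (exprS b); ring.
Qed.

Lemma Srq_add (m n r k : nat) :
  Srq r (m + n) k =
    \sum_(i < n.+1) \sum_(j < m.+1)
      'X^(i * (j + r)) * qint (j + r) ^+ (n - i) * ('C(n, i))%:R
        * Srq r m j * Sq i (k%:Z - j%:Z).
Proof.
(* [G] is the coefficient of S_q^(r)(m, j). Its powers are written so that [sum_binS] applies with a
   = q^(j+r) and b = [j+r]. *)
pose G n (j k : nat) := \sum_(i < n.+1)
  ('X^(j + r)) ^+ i * qint (j + r) ^+ (n - i) * ('C(n, i))%:R
   * Sq i (k%:Z - j%:Z).
have GE n' k' : \sum_(i < n'.+1) \sum_(j < m.+1)
      'X^(i * (j + r)) * qint (j + r) ^+ (n' - i) * ('C(n', i))%:R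
        * Srq r m j * Sq i (k'%:Z - j%:Z) = \sum_(j < m.+1) Srq r m j * G n' j k'.
  rewrite exchange_big; apply: eq_bigr => j _; rewrite mulr_sumr.
  by apply: eq_bigr => i _; rewrite mulnC exprM; ring.
rewrite GE; elim: n k => [|n IHn] k.
  (* For n = 0 the coefficient is S_q(0, k-j), which is 1 if j = k and 0 otherwise; the index j = k
     occurs exactly when k <= m. *)
  rewrite addn0.
  under eq_bigr do rewrite /G big_ord1 bin0 !expr0 !mul1r.
  have [mk|km] := ltnP m k.
    rewrite Srq_large // big1 // => j _.
    have jk : (j < k)%N by rewrite (leq_ltn_trans _ mk) // -ltnS.
    by rewrite subzn ?(ltnW jk) // Sq_large ?mulr0 // subn_gt0.
  rewrite (bigD1 (inord k)) //= inordK // subrr Sq00 mulr1 big1 ?addr0 // => j jk.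
  have {}jk : (j : nat) != k.
    by apply: contraNneq jk => <-; rewrite inord_val.
  have [jlt|kj] := ltnP j k.
    by rewrite subzn ?(ltnW jlt) // Sq_large ?mulr0 // subn_gt0.
  by rewrite Sq_lt0 ?mulr0 // subr_lt0 ltz_nat ltn_neqAle eq_sym jk.
(* For each fixed j, [G] obeys the recurrence of [Srq_rec], with coefficients free of j, so it can
   be summed over j. *)
have G_rec j k' : G n.+1 j k' =
    (if k' is k''.+1 then 'X^(k'' + r) * G n j k'' else 0) + qint (k' + r) * G n j k'.
  rewrite /G (sum_binS _ _ (fun i => Sq i (k'%:Z - j%:Z))).
  under eq_bigr do rewrite Sq_shift_rec mulrDr; rewrite big_split /=.
  congr (_ + _); last by rewrite mulr_sumr; apply: eq_bigr => i _; ring.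
  case: k' => [|k']; first by rewrite big1 // => i _; rewrite mulr0.
  by rewrite mulr_sumr; apply: eq_bigr => i _; ring.
rewrite addnS Srq_rec; under [RHS]eq_bigr do rewrite G_rec mulrDr.
rewrite big_split /=; congr (_ + _).
  case: k => [|k]; first by rewrite big1 // => j _; rewrite mulr0.
  by rewrite IHn mulr_sumr; apply: eq_bigr => j _; ring.
by rewrite IHn mulr_sumr; apply: eq_bigr => j _; ring.
Qed.

(** * Summation over the number of blocks *)

Lemma sum_Sq_shift (i j N : nat) : (i + j < N)%N ->
  \sum_(k < N) Sq i (k%:Z - j%:Z) = Bq i.
Proof.
move=> ijN; rewrite -(big_mkord xpredT (fun k => Sq i (k%:Z - j%:Z))).
(* Only j <= k <= i + j can contribute: cut at j, shift by j, then cut at i + 1. *)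
rewrite (@big_cat_nat _ _ _ j) //=; last by rewrite (leq_trans _ ijN) // leqW ?leq_addl.
rewrite big_nat big1 ?add0r => [|k /andP[_ kj]]; last first.
  by rewrite Sq_lt0 // subr_lt0 ltz_nat.
rewrite -{1}(add0n j) big_addn.
rewrite (@big_cat_nat _ _ _ i.+1) //=; last by rewrite ltn_subRL addnC.
rewrite [X in _ + X]big_nat [X in _ + X]big1 ?addr0 => [|k /andP[ik _]]; last first.
  by rewrite subzn ?leq_addl // addnK Sq_large.
rewrite big_mkord; apply: eq_bigr => k _.
by rewrite subzn ?leq_addl // addnK.
Qed.

Theorem theorem2p1 (m n r k : nat) :
  Srq r (m + n) k =
    \sum_(i < n.+1) \sum_(j < m.+1)
      'X^(i * (j + r)) * qint (j + r) ^+ (n - i) * ('C(n, i))%:R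
        * Srq r m j * Sq i (k%:Z - j%:Z)
  /\
  Brq r (m + n) =
    \sum_(i < n.+1) \sum_(j < m.+1)
      'X^(i * (j + r)) * qint (j + r) ^+ (n - i) * ('C(n, i))%:R
        * Srq r m j * Bq i.
Proof.
split; first exact: Srq_add.
rewrite /Brq; under eq_bigr do rewrite Srq_add.
rewrite exchange_big; apply: eq_bigr => i _.
rewrite exchange_big; apply: eq_bigr => j _.
(* The range k <= m + n contains all contributing k, as i <= n and j <= m. *)
rewrite -mulr_sumr sum_Sq_shift // ltnS addnC.
by rewrite leq_add // -ltnS.
Qed.
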